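(* Consider the iteratively reweighted $\ell_1$ algorithm described in the context, applied to the problem of minimizing $f_0(x)+\lambda\|x\|_p^p$ over a closed convex set $\Gamma=\{x\mid f_j(x)\le0\ \forall j\in\mathcal I,\ f_j(x)=0\ \forall j\in\mathcal E\}$, and suppose that: (i) with $F^0:=F(x^0;\epsilon^0)$, the level set $\{x\mid F(x)\le F^0\}$ is bounded; (ii) for all $k\in\mathbb{N}$, $\nabla Q_k(x^k)=\nabla f_0(x^k)$ and $Q_k$ is strongly convex with constant $M>L_f/2>0$. Let $\{x^k\}$ be the sequence generated by the algorithm. Then every cluster point of $\{x^k\}$ satisfies the AKKT condition.
   Context: Setting: $p\in(0,1]$, $\lambda>0$; $f_0:\mathbb{R}^n\to\mathbb{R}$ is continuously differentiable with Lipschitz gradient of constant $L_f\ge0$; the $f_j$, $j\in\mathcal I\cup\mathcal E$ (finite index sets), are continuously differentiable, and $\Gamma$ is closed and convex. $F(x)=f_0(x)+\lambda\sum_{i=1}^n|x_i|^p$ and, for $\epsilon\in\mathbb{R}^n_{++}$, $F(x;\epsilon)=f_0(x)+\lambda\sum_{i=1}^n(|x_i|+\epsilon_i)^p$. At iteration $k$, $Q_k:\mathbb{R}^n\to\mathbb{R}$ is a smooth convex local model of $f_0$ at $x^k$. Algorithm: choose $\alpha\in(0,1)$, $\epsilon^0\in\mathbb{R}^n_{++}$ and $x^0$. For $k=0,1,2,\dots$: compute the weights $w_i^k=p(|x_i^k|+\epsilon_i^k)^{p-1}$, $i=1,\dots,n$; set $x^{k+1}=\arg\min_{x\in\Gamma}\{Q_k(x)+\lambda\sum_{i=1}^nw_i^k|x_i|\}$;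 choose $\epsilon^{k+1}$ with $0<\epsilon_i^{k+1}<\alpha\epsilon_i^k$ for all $i$. AKKT condition at $\bar x\in\Gamma$: with $\bar{\mathcal N}=\{i\mid\bar x_i\ne0\}$ and $\bar{\mathcal A}=\{j\in\mathcal I\mid f_j(\bar x)=0\}$, there exist $z^\nu\in\mathbb{R}^n$ and $y_j^\nu\in\mathbb{R}$, $j\in\mathcal E\cup\bar{\mathcal A}$, with $z^\nu\to\bar x$, $y_j^\nu\ge0$ for $j\in\bar{\mathcal A}$, and $$\lim_{\nu\to\infty}\Big[\nabla_if_0(z^\nu)+\lambda p\,\mathrm{sign}(z_i^\nu)|z_i^\nu|^{p-1}+\sum_{j\in\mathcal E\cup\bar{\mathcal A}}y_j^\nu\nabla_if_j(z^\nu)\Big]=0\qquad\forall i\in\bar{\mathcal N}.$$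
   Formalization: ''Smooth'' for the models Q_k is strengthened: besides each Q_k being continuously differentiable, the gradients ∇Q_k are assumed equicontinuous uniformly in k; without this the claim fails (e.g. models with curvature growing like 2^k make the iterates stall). *)

(* Defs.v *)
From mathcomp Require Import all_boot all_order all_algebra.
From mathcomp Require Import all_classical all_reals all_analysis.
Set Implicit Arguments.
Unset Strict Implicit.
Unset Printing Implicit Defensive.
Import Order.TTheory GRing.Theory Num.Theory numFieldNormedType.Exports.
Local Open Scope classical_set_scope.
Local Open Scope ring_scope.

(* The norm `|x| that the library puts on 'rV[R]_n is the sup norm; the
   constants L_f and M are relative to the Euclidean one. *)
Definition enorm (R : realType) (n : nat) (x : 'rV[R]_n) : R :=
  Num.sqrt (\sum_(i < n) x 0 i ^+ 2).

Definition grad (R : realType) (n : nat) (f : 'rV[R]_n -> R) (x : 'rV[R]_n) :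
    'rV[R]_n :=
  \row_(i < n) 'D_(delta_mx 0 i) f x.

Definition continuously_differentiable (R : realType) (n : nat)
    (f : 'rV[R]_n -> R) : Prop :=
  (forall x, differentiable f x) /\ continuous (grad f).

Definition lipschitz_gradient (R : realType) (n : nat) (L : R)
    (f : 'rV[R]_n -> R) : Prop :=
  forall x y, enorm (grad f x - grad f y) <= L * enorm (x - y).

Definition strongly_convex (R : realType) (n : nat) (M : R)
    (f : 'rV[R]_n -> R) : Prop :=
  forall (x y : 'rV[R]_n) (t : R), 0 <= t <= 1 ->
    f (t *: x + (1 - t) *: y) <=
      t * f x + (1 - t) * f y - M / 2 * t * (1 - t) * enorm (x - y) ^+ 2.

Definition is_argmin (R : realType) (T : Type) (A : set T) (f : T -> R)
    (x : T) : Prop :=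
  A x /\ forall u, A u -> f x <= f u.

Definition feasible_set (R : realType) (n : nat) (I E : finType)
    (g : I -> 'rV[R]_n -> R) (h : E -> 'rV[R]_n -> R) : set 'rV[R]_n :=
  [set x | (forall j, g j x <= 0) /\ (forall j, h j x = 0)].

Definition objective (R : realType) (n : nat) (p lambda : R)
    (f0 : 'rV[R]_n -> R) (x : 'rV[R]_n) : R :=
  f0 x + lambda * \sum_(i < n) `|x 0 i| `^ p.

Definition smoothed_objective (R : realType) (n : nat) (p lambda : R)
    (f0 : 'rV[R]_n -> R) (x eps : 'rV[R]_n) : R :=
  f0 x + lambda * \sum_(i < n) (`|x 0 i| + eps 0 i) `^ p.

Definition weight (R : realType) (n : nat) (p : R) (x eps : 'rV[R]_n)
    (i : 'I_n) : R :=
  p * (`|x 0 i| + eps 0 i) `^ (p - 1).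

Definition reweighted_model (R : realType) (n : nat) (p lambda : R)
    (q : 'rV[R]_n -> R) (x eps u : 'rV[R]_n) : R :=
  q u + lambda * \sum_(i < n) weight p x eps i * `|u 0 i|.

(* The algorithm chooses eps^{k+1} freely within its bounds, so its runs are
   described by a relation. *)
Definition irl1_run (R : realType) (n : nat) (p lambda : R)
    (Gamma : set 'rV[R]_n) (Q : nat -> 'rV[R]_n -> R) (alpha : R)
    (x eps : nat -> 'rV[R]_n) : Prop :=
  [/\ 0 < alpha < 1,
      (forall i, 0 < eps 0%N 0 i),
      (forall k,
         is_argmin Gamma (reweighted_model p lambda (Q k) (x k) (eps k))
           (x k.+1)) &
      (forall k i, 0 < eps k.+1 0 i < alpha * eps k 0 i)].

(* The multipliers of inactive inequalities occur in no sum and are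
   unconstrained. *)
Definition AKKT (R : realType) (n : nat) (I E : finType) (p lambda : R)
    (f0 : 'rV[R]_n -> R) (g : I -> 'rV[R]_n -> R) (h : E -> 'rV[R]_n -> R)
    (xbar : 'rV[R]_n) : Prop :=
  feasible_set g h xbar /\
  exists (z : nat -> 'rV[R]_n) (yI : nat -> I -> R) (yE : nat -> E -> R),
    [/\ z @ \oo --> xbar,
        (forall nu j, g j xbar = 0 -> 0 <= yI nu j) &
        (forall i, xbar 0 i != 0 ->
           (fun nu =>
              grad f0 (z nu) 0 i
              + lambda * p * Num.sg (z nu 0 i) * `|z nu 0 i| `^ (p - 1)
              + (\sum_(j : E) yE nu j * grad (h j) (z nu) 0 i
                 + \sum_(j : I | g j xbar == 0)
                     yI nu j * grad (g j) (z nu) 0 i))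
           @ \oo --> (0 : R))].

(* Main.v *)
Require Import Defs.
From mathcomp Require Import all_boot all_order all_algebra.
From mathcomp Require Import all_classical all_reals all_analysis.
From mathcomp Require Import ring lra.
Set Implicit Arguments.
Unset Strict Implicit.
Unset Printing Implicit Defensive.
Import Order.TTheory GRing.Theory Num.Theory numFieldNormedType.Exports.
Local Open Scope classical_set_scope.
Local Open Scope ring_scope.

(** The iterates satisfy a sufficient decrease property, so that consecutive
    iterates draw together; passing to the limit in the optimality conditions
    of the convex subproblems shows that a cluster point is stationary on the
    face of the feasible set where its zero coordinates stay zero; and a
    stationary point satisfies AKKT, without any constraint qualification, by a
    penalty argument.

    Decrease. The tangent line of the concave function t `^ p bounds the
    smoothed objective by the weighted l1 model, the quadratic upper bound of
    [descent_lemma] bounds f0, and the strong convexity of the model is used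
    twice: at its minimizer x^{k+1} ([strong_argmin_growth]) and as a lower
    bound from x^k ([strongly_convex_gradient]). Together they give
    [reweighted_step_decrease]: the smoothed objective drops by at least
    (M - L/2) |x^{k+1} - x^k|^2. The starting point may be infeasible, so this
    holds from the first iterate on only. That iterate may lie outside the
    bounded level set, but the objective is nevertheless bounded below on the
    whole space: by compactness on the level set, by the level outside it
    ([objective_lower_bound]). Hence x^{k+1} - x^k tends to 0.

    Limit. Let x^k tend to xbar along a subsequence; then so does x^{k+1}, and
    by equicontinuity the gradient of Q_k at x^{k+1} tends to that of f0 at
    xbar. The variational inequality of the k-th subproblem, tested at a
    feasible u that vanishes where xbar does, has weights that may blow up only
    at the zero coordinates of xbar; there the terms have a favourable sign and
    can be dropped. The limit is the first-order condition
    of [limit_variational].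

    AKKT. That condition says that xbar is a local minimizer of a linear
    function over the feasible set intersected with the subspace of the vectors that
    vanish where xbar does. [sequential_optimality] minimizes this linear
    function, plus a small strictly convex term and a large multiple of the
    squared constraint violation, over a small box around xbar. The minimizer
    is interior, and the vanishing of the gradient there is the approximate KKT
    system, with the scaled violations as multipliers. The multipliers of the
    subspace constraints appear only in the rows i with xbar_i = 0, which AKKT
    does not mention. *)

(** * Euclidean geometry and directional derivatives *)

Definition dot (R : realType) (n : nat) (u v : 'rV[R]_n) : R :=
  \sum_(i < n) u 0 i * v 0 i.

Lemma enorm_ge0 (R : realType) (n : nat) (u : 'rV[R]_n) : 0 <= enorm u.
Proof. exact: sqrtr_ge0. Qed.

Lemma enorm_sqr (R : realType) (n : nat) (u : 'rV[R]_n) :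
  enorm u ^+ 2 = \sum_(i < n) u 0 i ^+ 2.
Proof. by rewrite sqr_sqrtr// sumr_ge0// => i _; rewrite sqr_ge0. Qed.

Lemma enormZ (R : realType) (n : nat) (t : R) (u : 'rV[R]_n) :
  0 <= t -> enorm (t *: u) = t * enorm u.
Proof.
move=> t0; rewrite /enorm.
under eq_bigr do rewrite mxE exprMn.
by rewrite -mulr_sumr sqrtrM ?sqr_ge0// sqrtr_sqr ger0_norm.
Qed.

Lemma coord_le_enorm (R : realType) (n : nat) (u : 'rV[R]_n) (i : 'I_n) :
  `|u 0 i| <= enorm u.
Proof.
rewrite -sqrtr_sqr ler_sqrt; last by rewrite sumr_ge0// => j _; rewrite sqr_ge0.
by rewrite (bigD1 i)//= lerDl sumr_ge0// => j _; rewrite sqr_ge0.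
Qed.

Lemma dotBl (R : realType) (n : nat) (u v w : 'rV[R]_n) :
  dot (u - v) w = dot u w - dot v w.
Proof.
by rewrite -sumrB; apply: eq_bigr => i _; rewrite !mxE mulrBl.
Qed.

Lemma dot_delta (R : realType) (n : nat) (u : 'rV[R]_n) (i : 'I_n) :
  dot u (delta_mx 0 i) = u 0 i.
Proof.
rewrite /dot (bigD1 i)//= mxE !eqxx mulr1 big1 ?addr0// => j /negPf ji.
by rewrite mxE eqxx ji mulr0.
Qed.

(** The Cauchy-Schwarz inequality, from the expansion of the square of
    |v| u - |u| v. *)
Lemma dot_le_enorm (R : realType) (n : nat) (u v : 'rV[R]_n) :
  dot u v <= enorm u * enorm v.
Proof.
have h : 0 <= \sum_(i < n) (enorm v * u 0 i - enorm u * v 0 i) ^+ 2.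
  by rewrite sumr_ge0// => i _; rewrite sqr_ge0.
have : 0 <= (enorm u * enorm v) * (enorm u * enorm v - dot u v).
  move: h; under eq_bigr do rewrite sqrrB !exprMn.
  rewrite !big_split/= sumrN -!mulr_sumr -!enorm_sqr.
  have -> : \sum_(i < n) enorm v * u 0 i * (enorm u * v 0 i) *+ 2 =
      2 * (enorm u * enorm v) * dot u v.
    by rewrite /dot mulr_sumr; apply: eq_bigr => i _; rewrite -mulr_natl; ring.
  move=> h; nra.
have [uv0|uv0] := ltP 0 (enorm u * enorm v).
  by rewrite pmulr_rge0// subr_ge0.
(* otherwise one of the two vectors vanishes *)
have uv : enorm u * enorm v = 0.
  by apply: le_anti; rewrite uv0 mulr_ge0// enorm_ge0.
move=> _; rewrite uv /dot big1// => i _.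
have := coord_le_enorm u i; have := coord_le_enorm v i.
move/eqP : uv; rewrite mulf_eq0 => /orP[]/eqP ->; rewrite !normr_le0.
  by move=> _ /eqP ->; rewrite mul0r.
by move=> /eqP -> _; rewrite mulr0.
Qed.

Lemma derive_dot_grad (R : realType) (n : nat) (f : 'rV[R]_n -> R)
    (x v : 'rV[R]_n) :
  differentiable f x -> 'D_v f x = dot (grad f x) v.
Proof.
move=> df; rewrite deriveE// {1}[v]row_sum_delta linear_sum/=.
apply: eq_bigr => i _; rewrite linearZ/= mxE deriveE// /GRing.scale/= mulrC.
by [].
Qed.

Lemma is_derive_line (R : realType) (n : nat) (f : 'rV[R]_n -> R)
    (x v : 'rV[R]_n) (t : R) :
  differentiable f (x + t *: v) ->
  is_derive t 1 (fun s => f (x + s *: v)) (dot (grad f (x + t *: v)) v).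
Proof.
move=> df.
have dl : is_diff t (fun s : R => x + s *: v) (fun s => s *: v).
  by apply: is_diff_eq; apply/funext => s; rewrite /= add0r.
have dc : is_diff t (f \o (fun s : R => x + s *: v))
    ('d f (x + t *: v) \o (fun s => s *: v)).
  by apply: is_diff_comp => //; apply: DiffDef.
split; first by apply: diff_derivable.
rewrite deriveE// -derive_dot_grad// deriveE//.
have /(congr1 (fun F => F 1)) /= := @diff_val _ _ _ _ _ _ _ dc.
by rewrite scale1r.
Qed.

Lemma derive_ge0_right_min (R : realType) (f : R -> R) (d : R) :
  is_derive (0 : R) 1 f d -> (forall t, 0 <= t <= 1 -> f 0 <= f t) -> 0 <= d.
Proof.
move=> [df <-] fmin.
have /cvg_dnbhs_at_right df0 := df.
rewrite /derive -(cvg_lim (@Rhausdorff R) df0).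
apply: limr_ge; first by apply/cvg_ex; eexists; exact: df0.
near=> t; rewrite /GRing.scale/= mulr1 addr0 mulr_ge0 ?invr_ge0 ?subr_ge0//.
apply: fmin; apply/andP; split=> //; near: t; exact: nbhs_right_le.
Unshelve. all: by end_near. Qed.

(** The error f (x + t v) - f x - t <grad f x, v> - L/2 t^2 |v|^2 has a
    nonpositive derivative in t, because the gradient moves by at most L t |v|;
    so it decreases from 0 on [0, 1]. *)
Lemma descent_lemma (R : realType) (n : nat) (L : R) (f : 'rV[R]_n -> R)
    (x y : 'rV[R]_n) :
  (forall u, differentiable f u) -> lipschitz_gradient L f ->
  f y <= f x + dot (grad f x) (y - x) + L / 2 * enorm (y - x) ^+ 2.
Proof.
move=> df fL; set v := y - x.
pose D t := dot (grad f (x + t *: v)) v.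
pose e t : R :=
  f (x + t *: v) - t * dot (grad f x) v - L / 2 * enorm v ^+ 2 * t ^+ 2.
have de (t : R) :
    is_derive t 1 e (D t - dot (grad f x) v - L * enorm v ^+ 2 * t).
  have ? := is_derive_line (df (x + t *: v)).
  apply: is_derive_eq.
  by rewrite /D /GRing.scale/=; field.
have : e 1 <= e 0.
  apply: (@ler0_derive1_nincr _ e 0 1) => //.
  - move=> t; rewrite in_itv/= => /andP[t0 _].
    rewrite derive1E derive_val /D -dotBl subr_le0.
    apply: (le_trans (dot_le_enorm _ _)).
    have := fL (x + t *: v) x.
    rewrite [x + _ - x]addrC addKr enormZ ?(ltW t0)// => h.
    have := ler_wpM2r (enorm_ge0 v) h; nra.
  - apply: continuous_subspaceT => t.
    by apply/differentiable_continuous/derivable1_diffP.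
have -> : y = x + 1 *: v by rewrite scale1r /v addrC subrK.
by rewrite /e scale0r addr0; lra.
Qed.

(** * Minimizers over convex sets *)

Lemma convex_set_line (R : realType) (n : nat) (A : set 'rV[R]_n)
    (x y : 'rV[R]_n) (t : R) :
  convex_set A -> A x -> A y -> 0 <= t <= 1 -> A (x + t *: (y - x)).
Proof.
move=> Aconv Ax Ay /andP[t0 t1].
have := Aconv y x (Itv01 t0 t1); rewrite !inE => /(_ Ay Ax).
rewrite /conv/= /unstable.onem scalerBl scale1r.
suff -> : x + t *: (y - x) = t *: y + (x - t *: x) by [].
by rewrite scalerBr addrCA.
Qed.

(** The first-order condition in a form that asks no differentiability of psi:
    along the segment to u, psi is bounded by its chord, so only q is
    differentiated. *)
Lemma argmin_variational (R : realType) (n : nat) (A : set 'rV[R]_n)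
    (q psi : 'rV[R]_n -> R) (y u : 'rV[R]_n) :
  convex_set A -> differentiable q y ->
  (forall v w (t : R), 0 <= t <= 1 ->
     psi (v + t *: (w - v)) <= psi v + t * (psi w - psi v)) ->
  is_argmin A (fun v => q v + psi v) y -> A u ->
  psi y <= psi u + dot (grad q y) (u - y).
Proof.
move=> Aconv dq psiconv [Ay ymin] Au.
pose e (t : R) : R := q (y + t *: (u - y)) + t * (psi u - psi y).
have de : is_derive (0 : R) 1 e (dot (grad q y) (u - y) + (psi u - psi y)).
  have := @is_derive_line _ _ q y (u - y) 0; rewrite scale0r addr0 => /(_ dq) ?.
  apply: is_derive_eq.
  by rewrite /GRing.scale/=; ring.
suff : 0 <= dot (grad q y) (u - y) + (psi u - psi y) by lra.
apply: derive_ge0_right_min de _ => t t01.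
rewrite /e scale0r addr0 mul0r addr0.
have := ymin _ (convex_set_line Aconv Ay Au t01).
have := psiconv y u _ t01; lra.
Qed.

(** With D the gap of the objective and d the quadratic term, strong convexity
    on the segment from y to u and minimality at y make t D - t (1 - t) d
    nonnegative on [0, 1]; it vanishes at t = 0, so its slope D - d there is
    nonnegative. *)
Lemma strong_argmin_growth (R : realType) (n : nat) (A : set 'rV[R]_n)
    (M : R) (q psi : 'rV[R]_n -> R) (y u : 'rV[R]_n) :
  convex_set A -> strongly_convex M q ->
  (forall v w (t : R), 0 <= t <= 1 ->
     psi (v + t *: (w - v)) <= psi v + t * (psi w - psi v)) ->
  is_argmin A (fun v => q v + psi v) y -> A u ->
  q y + psi y + M / 2 * enorm (u - y) ^+ 2 <= q u + psi u.
Proof.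
move=> Aconv sq psiconv [Ay ymin] Au.
set d := M / 2 * _; set D := q u + psi u - (q y + psi y).
suff : 0 <= D - d by rewrite /D; lra.
pose e (t : R) : R := t * D - t * (1 - t) * d.
have de : is_derive (0 : R) 1 e (D - d).
  apply: is_derive_eq.
  by rewrite /GRing.scale/=; ring.
apply: derive_ge0_right_min de _ => t t01.
rewrite /e /D !mul0r subrr.
have := ymin _ (convex_set_line Aconv Ay Au t01).
have := psiconv y u _ t01; have := sq u y _ t01.
rewrite (_ : t *: u + (1 - t) *: y = y + t *: (u - y)); last first.
  by rewrite scalerBl scale1r scalerBr addrCA.
by rewrite /d; lra.
Qed.

Lemma strongly_convex_gradient (R : realType) (n : nat) (M : R)
    (q : 'rV[R]_n -> R) (x y : 'rV[R]_n) :
  strongly_convex M q -> differentiable q x ->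
  q x + dot (grad q x) (y - x) + M / 2 * enorm (y - x) ^+ 2 <= q y.
Proof.
move=> sq dq; set d := M / 2 * _.
suff : 0 <= q y - q x - d - dot (grad q x) (y - x) by lra.
pose e (t : R) : R :=
  t * (q y - q x) - t * (1 - t) * d - q (x + t *: (y - x)).
have de : is_derive (0 : R) 1 e (q y - q x - d - dot (grad q x) (y - x)).
  have := @is_derive_line _ _ q x (y - x) 0; rewrite scale0r addr0 => /(_ dq) ?.
  apply: is_derive_eq.
  by rewrite /GRing.scale/=; ring.
apply: derive_ge0_right_min de _ => t t01.
rewrite /e scale0r addr0 !mul0r.
have := sq y x _ t01.
rewrite (_ : t *: y + (1 - t) *: x = x + t *: (y - x)); last first.
  by rewrite scalerBl scale1r scalerBr addrCA.
by rewrite /d; lra.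
Qed.

(** * Quadratic penalty of a constraint system *)

Lemma is_derive_bigsum (R : realType) (V : normedModType R) (I : Type)
    (r : seq I) (F : I -> V -> R) (dF : I -> R) (x v : V) :
  (forall i, is_derive x v (F i) (dF i)) ->
  is_derive x v (fun y => \sum_(i <- r) F i y) (\sum_(i <- r) dF i).
Proof.
move=> dFi; elim: r => [|i r ih].
  rewrite big_nil (_ : (fun _ => _) = cst 0); last first.
    by apply/funext => y; rewrite big_nil.
  exact: is_derive_cst.
rewrite big_cons (_ : (fun _ => _) = F i \+ (fun y => \sum_(i <- r) F i y)).
  exact: is_deriveD.
by apply/funext => y; rewrite big_cons.
Qed.

Lemma differentiable_bigsum (R : realType) (V : normedModType R) (I : Type)
    (r : seq I) (F : I -> V -> R) (x : V) :
  (forall i, differentiable (F i) x) ->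
  differentiable (fun y => \sum_(i <- r) F i y) x.
Proof.
move=> dFi; elim: r => [|i r ih].
  rewrite (_ : (fun _ => _) = cst 0); last first.
    by apply/funext => y; rewrite big_nil.
  exact: differentiable_cst.
rewrite (_ : (fun _ => _) = F i \+ (fun y => \sum_(i <- r) F i y)).
  exact: differentiableD.
by apply/funext => y; rewrite big_cons.
Qed.

Lemma is_derive_comp_scalar (R : realType) (V : normedModType R) (f : V -> R)
    (phi : R -> R) (d : R) (x v : V) :
  differentiable f x -> is_derive (f x) 1 phi d ->
  is_derive x v (phi \o f) (d * 'D_v f x).
Proof.
move=> df [/derivable1_diffP dphi dval].
have dc : differentiable (phi \o f) x by exact: differentiable_comp.
split; first exact: diff_derivable.
rewrite deriveE// diff_comp//= deriveE// deriv1E; last exact: diff_derivable.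
by rewrite derive1E dval /GRing.scale/= mulrC.
Qed.

(** The squared positive part is differentiable also at 0, since its
    difference quotient is within |h| of the claimed derivative. *)
Lemma is_derive_sqr_pos (R : realType) (x : R) :
  is_derive x 1 (fun t => Num.max t 0 ^+ 2) (2 * Num.max x 0).
Proof.
pose quot (h : R) := h^-1 *: (Num.max (h *: 1 + x) 0 ^+ 2 - Num.max x 0 ^+ 2).
suff cvq : quot h @[h --> 0^'] --> 2 * Num.max x 0.
  split; first by apply/cvg_ex; exists (2 * Num.max x 0).
  exact: cvg_lim cvq.
apply/cvgrPdist_le => e e0; near=> h.
have h0 : h != 0 by near: h; exact: nbhs_dnbhs_neq.
have he : `|h| <= e.
  near: h; apply: dnbhs0_le => //.
rewrite (le_trans _ he)// /quot /GRing.scale/= mulr1.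
have h1 : 0 < `|h| by rewrite normr_gt0.
rewrite -(ler_pM2l h1) -!normrM mulrBr mulVKf//.
rewrite [`|h * h|]ger0_norm -?expr2 ?sqr_ge0// ler_norml expr2.
by case: (leP (h + x) 0); case: (leP x 0) => *; apply/andP; split; nra.
Unshelve. all: by end_near. Qed.

Lemma compact_box (R : realType) (n : nat) (x : 'rV[R]_n) (r : R) :
  compact [set u : 'rV[R]_n | forall i, `|u 0 i - x 0 i| <= r].
Proof.
have := @rV_compact R n (fun i => `[x 0 i - r, x 0 i + r]%classic).
move=> /(_ (fun i => @segment_compact _ _ _)).
congr compact; apply/seteqP; split => u /= ur i; have := ur i;
  by rewrite in_itv/= ler_distlC; lra.
Qed.

Definition penalty (R : realType) (n : nat) (I E : finType)
    (g : I -> 'rV[R]_n -> R) (h : E -> 'rV[R]_n -> R) (u : 'rV[R]_n) : R :=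
  \sum_j h j u ^+ 2 + \sum_j Num.max (g j u) 0 ^+ 2.

Lemma penalty_ge0 (R : realType) (n : nat) (I E : finType)
    (g : I -> 'rV[R]_n -> R) (h : E -> 'rV[R]_n -> R) (u : 'rV[R]_n) :
  0 <= penalty g h u.
Proof. by rewrite addr_ge0// sumr_ge0// => j _; rewrite sqr_ge0. Qed.

Lemma penalty_eq0 (R : realType) (n : nat) (I E : finType)
    (g : I -> 'rV[R]_n -> R) (h : E -> 'rV[R]_n -> R) (u : 'rV[R]_n) :
  penalty g h u = 0 <-> feasible_set g h u.
Proof.
split=> [|[gu hu]]; last first.
  rewrite /penalty !big1 ?addr0// => j _.
    by rewrite (max_idPr (gu j)) expr0n.
  by rewrite hu expr0n.
move/eqP; rewrite paddr_eq0 ?sumr_ge0//; try by move=> j _; rewrite sqr_ge0.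
rewrite !psumr_eq0; try by move=> j _; rewrite sqr_ge0.
move=> /andP[/allP hu /allP gu]; split => j.
  have := gu j (mem_index_enum _); rewrite sqrf_eq0 => /eqP <-.
  by rewrite le_max lexx.
by have := hu j (mem_index_enum _); rewrite sqrf_eq0 => /eqP.
Qed.

Lemma differentiable_penalty (R : realType) (n : nat) (I E : finType)
    (g : I -> 'rV[R]_n -> R) (h : E -> 'rV[R]_n -> R) (u : 'rV[R]_n) :
  (forall j, differentiable (g j) u) -> (forall j, differentiable (h j) u) ->
  differentiable (penalty g h) u.
Proof.
move=> dg dh; apply: differentiableD; apply: differentiable_bigsum => j.
  by have := differentiableX 1 (dh j); rewrite exprfctE.
apply: (@differentiable_comp _ _ _ _ (g j) (fun t => Num.max t 0 ^+ 2)) => //.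
by apply/derivable1_diffP; have [] := is_derive_sqr_pos (g j u).
Qed.

Lemma is_derive_penalty (R : realType) (n : nat) (I E : finType)
    (g : I -> 'rV[R]_n -> R) (h : E -> 'rV[R]_n -> R) (u v : 'rV[R]_n) :
  (forall j, differentiable (g j) u) -> (forall j, differentiable (h j) u) ->
  is_derive u v (penalty g h)
    (\sum_j 2 * h j u * 'D_v (h j) u
     + \sum_j 2 * Num.max (g j u) 0 * 'D_v (g j) u).
Proof.
move=> dg dh; apply: is_deriveD; apply: is_derive_bigsum => j.
  have /derivableP ? : derivable (h j) u v by exact: diff_derivable.
  by apply: is_derive_eq; rewrite /GRing.scale/=; ring.
exact: (is_derive_comp_scalar _ (dg j) (is_derive_sqr_pos (g j u))).
Qed.

Lemma grad_eq0_at_min (R : realType) (n : nat) (f : 'rV[R]_n -> R)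
    (z : 'rV[R]_n) (r : R) :
  (forall u, differentiable f u) -> 0 < r ->
  (forall u : 'rV[R]_n, (forall i, `|u 0 i - z 0 i| <= r) -> f z <= f u) ->
  grad f z = 0.
Proof.
move=> df r0 zmin; apply/rowP => i; rewrite [RHS]mxE -dot_delta.
pose e (t : R) : R := f (z + t *: delta_mx 0 i).
have de (t : R) := is_derive_line (df (z + t *: delta_mx 0 i)).
have [_ <-] : is_derive (0 : R) 1 e 0.
  apply: (@derive1_at_min _ e (- r) r).
  - lra.
  - by move=> t _; have [] := de t.
  - by rewrite in_itv/=; lra.
  - move=> t; rewrite in_itv/= => tr; rewrite /e scale0r addr0.
    apply: zmin => k.
    rewrite !mxE eqxx/= addrAC subrr add0r normrM.
    rewrite (le_trans (ler_piMr _ _)) ?normr_ge0 //.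
    + by case: (k == i); rewrite ?normr1 ?normr0.
    + by rewrite ler_norml; lra.
by have [_ ->] := de 0; rewrite scale0r addr0.
Qed.

Lemma is_derive_coord (R : realType) (n : nat) (i : 'I_n) (x v : 'rV[R]_n) :
  is_derive x v (fun u : 'rV[R]_n => u 0 i) (v 0 i).
Proof.
have dc := @differentiable_coord R 1 n x 0 i.
split; first exact: diff_derivable.
rewrite /derive; apply: cvg_lim => //.
apply: cvg_near_cst; near=> t.
have t0 : t != 0 by near: t; exact: nbhs_dnbhs_neq.
by rewrite /= !mxE addrK /GRing.scale/= mulKf.
Unshelve. all: by end_near. Qed.

Lemma differentiable_dot (R : realType) (n : nat) (c x : 'rV[R]_n) :
  differentiable (dot c) x.
Proof.
apply: differentiable_bigsum => i.
apply: differentiableM => //; exact: differentiable_coord.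
Qed.

Lemma grad_dot (R : realType) (n : nat) (c x : 'rV[R]_n) :
  grad (dot c) x = c.
Proof.
apply/rowP => i; rewrite mxE -[RHS]dot_delta; apply: derive_val.
apply: is_derive_bigsum => k; have ? := is_derive_coord k x (delta_mx 0 i).
by apply: is_derive_eq; rewrite /GRing.scale/=; ring.
Qed.

(** The square of [enorm (u - x)], as a polynomial in the coordinates of u. *)
Definition sqdist (R : realType) (n : nat) (x u : 'rV[R]_n) : R :=
  \sum_(i < n) (u 0 i - x 0 i) ^+ 2.

Lemma differentiable_sqdist (R : realType) (n : nat) (x u : 'rV[R]_n) :
  differentiable (sqdist x) u.
Proof.
apply: differentiable_bigsum => i.
have := @differentiableX _ _ (fun u : 'rV[R]_n => u 0 i - x 0 i) 1 u.
rewrite exprfctE; apply.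
apply: differentiableB => //; exact: differentiable_coord.
Qed.

Lemma grad_sqdist (R : realType) (n : nat) (x u : 'rV[R]_n) :
  grad (sqdist x) u = 2 *: (u - x).
Proof.
apply/rowP => i; rewrite mxE -[RHS]dot_delta; apply: derive_val.
apply: is_derive_bigsum => k; have ? := is_derive_coord k u (delta_mx 0 i).
by apply: is_derive_eq; rewrite /GRing.scale/= !mxE; ring.
Qed.

(** * Approximate KKT points from penalized minimization *)

(** Neighbourhoods in the form of the compact boxes used for minimization. *)
Lemma near_box (R : realType) (n : nat) (x : 'rV[R]_n) (P : set 'rV[R]_n) :
  (\forall u \near x, P u) ->
  exists2 r : R, 0 < r &
    forall u : 'rV[R]_n, (forall i, `|u 0 i - x 0 i| <= r) -> P u.
Proof.
move=> /nbhs_ballP[e /= e0 eP]; exists (e / 2); first by rewrite divr_gt0.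
move=> u ur; apply: eP; split=> // i j; rewrite ord1 /ball/= distrC.
by rewrite (le_lt_trans (ur j))// ltr_pdivrMr// ltr_pMr// ltr1n.
Qed.

Lemma sqdistxx (R : realType) (n : nat) (x : 'rV[R]_n) : sqdist x x = 0.
Proof. by rewrite /sqdist big1// => i _; rewrite subrr expr0n. Qed.

Lemma sqdist_lt_coord (R : realType) (n : nat) (x u : 'rV[R]_n) (r : R) i :
  0 < r -> sqdist x u < r ^+ 2 -> `|u 0 i - x 0 i| < r.
Proof.
move=> r0; rewrite /sqdist (bigD1 i)//= => ur.
rewrite -(@ltr_pXn2r _ 2) ?nnegrE ?(ltW r0)// real_normK ?num_real//.
apply: le_lt_trans ur; rewrite lerDl sumr_ge0// => j _; exact: sqr_ge0.
Qed.

(** A finite penalty parameter lifts q above q xbar on the part of the box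
    away from xbar. Only the compact set of the points with q u <= q xbar
    matters; by hypothesis none of them is feasible, so the penalty has a positive minimum
    there, while q is bounded below. *)
Lemma exact_penalty_on_box (R : realType) (n : nat) (I E : finType)
    (q : 'rV[R]_n -> R) (g : I -> 'rV[R]_n -> R) (h : E -> 'rV[R]_n -> R)
    (xbar : 'rV[R]_n) (r : R) :
  (forall u, differentiable q u) ->
  (forall j u, differentiable (g j) u) ->
  (forall j u, differentiable (h j) u) ->
  (forall u : 'rV[R]_n, (forall i, `|u 0 i - xbar 0 i| <= r) ->
     r ^+ 2 <= sqdist xbar u -> feasible_set g h u -> q xbar < q u) ->
  exists2 nu : R, 0 <= nu & forall u : 'rV[R]_n,
    (forall i, `|u 0 i - xbar 0 i| <= r) -> r ^+ 2 <= sqdist xbar u ->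
    q xbar < q u + nu * penalty g h u.
Proof.
move=> dq dg dh qS.
pose B := [set u : 'rV[R]_n | forall i, `|u 0 i - xbar 0 i| <= r].
pose A := B `&` [set u | r ^+ 2 <= sqdist xbar u] `&` [set u | q u <= q xbar].
have cq : continuous q by move=> u; exact: differentiable_continuous.
have cpi : continuous (penalty g h).
  by move=> u; apply: differentiable_continuous; exact: differentiable_penalty.
have cs : continuous (sqdist xbar).
  by move=> u; apply: differentiable_continuous; exact: differentiable_sqdist.
have cA : compact A.
  apply: compact_closedI; last first.
    exact: (closed_comp (fun u _ => cq u) (@closed_le _ (q xbar))).
  apply: compact_closedI; first exact: compact_box.
  exact: (closed_comp (fun u _ => cs u) (@closed_ge _ (r ^+ 2))).
have [A0|/negP/negP] := eqVneq A set0.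
  exists 0 => // u Bu Su; rewrite mul0r addr0 ltNge; apply/negP => qu.
  by have : A u by []; rewrite A0.
move=> /set0P A0.
have [c /set_mem Ac cmin] := EVT_min_rV A0 cA (continuous_subspaceT cq).
have [a /set_mem [[Ba Sa] qa] amin] :=
  EVT_min_rV A0 cA (continuous_subspaceT cpi).
have pia : 0 < penalty g h a.
  rewrite lt_neqAle penalty_ge0 andbT eq_sym; apply/eqP => /penalty_eq0 fa.
  by have := qS _ Ba Sa fa; rewrite ltNge qa.
have qc : q c <= q xbar by case: Ac.
(* q c is the least value of q, and penalty g h a the least penalty, on A; the
   summand 1 makes the inequality strict. *)
exists ((q xbar - q c + 1) / penalty g h a).
  by rewrite divr_ge0 ?penalty_ge0//; lra.
move=> u Bu Su; have [qu|qu] := leP (q u) (q xbar); last first.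
  apply: (lt_le_trans qu); rewrite lerDl mulr_ge0 ?penalty_ge0//.
  by rewrite divr_ge0 ?penalty_ge0//; lra.
have Au : A u by [].
have h1 :
    q xbar - q c + 1 <= (q xbar - q c + 1) / penalty g h a * penalty g h u.
  rewrite -mulrA ler_peMr//; first lra.
  by rewrite ler_pdivlMl// mulr1 amin// inE.
by have := cmin u (mem_set Au); lra.
Qed.

(** Local minimizers are approximate KKT points without any constraint
    qualification. Half the squared distance to xbar makes xbar a strict
    minimizer; by [exact_penalty_on_box], the penalized function then has its
    minimum over a small box at an interior point z, and the gradient there
    vanishes. The quadratic term contributes z - xbar, which is the residual;
    the box is so small that inactive inequalities remain strict and receive
    the multiplier 0. *)
Lemma sequential_optimality (R : realType) (n : nat) (I E : finType)
    (phi : 'rV[R]_n -> R) (g : I -> 'rV[R]_n -> R) (h : E -> 'rV[R]_n -> R)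
    (xbar : 'rV[R]_n) (eta : R) :
  (forall u, differentiable phi u) ->
  (forall j u, differentiable (g j) u) ->
  (forall j u, differentiable (h j) u) ->
  feasible_set g h xbar ->
  (\forall u \near xbar, feasible_set g h u -> phi xbar <= phi u) ->
  0 < eta ->
  exists (z : 'rV[R]_n) (yI : I -> R) (yE : E -> R),
    [/\ forall i, `|z 0 i - xbar 0 i| < eta,
        forall j, 0 <= yI j,
        forall j, g j xbar < 0 -> yI j = 0 &
        forall i, `|grad phi z 0 i + (\sum_j yE j * grad (h j) z 0 i
                    + \sum_j yI j * grad (g j) z 0 i)| < eta].
Proof.
move=> dphi dg dh fxbar minxbar eta0.
have near_inactive : \forall u \near xbar, forall j, g j xbar < 0 -> g j u < 0.
  have near_j j : \forall u \near xbar, g j xbar < 0 -> g j u < 0.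
    have cg := differentiable_continuous (dg j xbar).
    have [gj|_] := ltP (g j xbar) 0; last by near=> u.
    by near=> u => _; near: u; apply: (cvgr_lt (g j xbar) cg).
  exact: filter_forall near_j.
have [rho rho0 rhoP] := near_box (filterI minxbar near_inactive).
pose r : R := Num.min rho (eta / 2).
have r0 : 0 < r by rewrite lt_min rho0 divr_gt0.
have r_rho : r <= rho by rewrite ge_min lexx.
have r_eta : r < eta by rewrite gt_min orbC ltr_pdivrMr// ltr_pMr// ltr1n.
pose q u := phi u + 2^-1 * sqdist xbar u.
have dq u : differentiable q u.
  apply: differentiableD => //; apply: differentiableM => //.
  exact: differentiable_sqdist.
have qxbar : q xbar = phi xbar by rewrite /q sqdistxx mulr0 addr0.
have [|nu nu0 nuP] := exact_penalty_on_box dq dg dh (xbar := xbar) (r := r).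
  move=> u Bu Su fu; rewrite qxbar.
  have [/(_ fu)] := rhoP u (fun i => le_trans (Bu i) r_rho).
  rewrite /q; have := exprn_gt0 2 r0; lra.
pose P u := q u + nu * penalty g h u.
have dP u : differentiable P u.
  apply: differentiableD => //; apply: differentiableM => //.
  exact: differentiable_penalty.
have [|z /set_mem zB zmin] := EVT_min_rV _ (@compact_box R n xbar r)
    (continuous_subspaceT (fun u => differentiable_continuous (dP u))).
  by exists xbar => i /=; rewrite subrr normr0 ltW.
have zS : sqdist xbar z < r ^+ 2.
  rewrite ltNge; apply/negP => /(nuP _ zB); apply/negP; rewrite -leNgt.
  have := zmin xbar; rewrite /P (penalty_eq0 g h xbar).2// mulr0 addr0; apply.
  by rewrite inE => i /=; rewrite subrr normr0 ltW.
have zr i := sqdist_lt_coord i r0 zS.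
(* s is a lower bound for the distance from z to the faces of the box; the 1
   makes it positive for n = 0 as well. *)
pose s := \big[Num.min/1]_(i < n) (r - `|z 0 i - xbar 0 i|).
have gradP : grad P z = 0.
  apply: (@grad_eq0_at_min _ _ _ _ s) => //.
    by apply/bigmin_gtP; split=> // i _; rewrite subr_gt0.
  move=> u us; apply: zmin; rewrite inE => i /=.
  have : s <= r - `|z 0 i - xbar 0 i| by exact: bigmin_le_cond.
  have := us i; have := ler_distD (z 0 i) (u 0 i) (xbar 0 i); lra.
(* the derivatives of nu h_j^2 and nu (max g_j 0)^2 provide the multipliers *)
exists z, (fun j => nu * (2 * Num.max (g j z) 0)), (fun j => nu * (2 * h j z)).
split.
- by move=> i; exact: lt_trans r_eta.
- by move=> j; rewrite !mulr_ge0// le_max lexx orbT.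
- move=> j gj; have [_ /(_ j gj)] := rhoP z (fun i => le_trans (zB i) r_rho).
  by move=> /ltW/max_idPr ->; rewrite !mulr0.
- move=> i; have /rowP/(_ i) := gradP; rewrite !mxE.
  have /derivableP ? : derivable phi z (delta_mx 0 i) by exact: diff_derivable.
  have ? : is_derive z (delta_mx 0 i) (sqdist xbar) (2 * (z 0 i - xbar 0 i)).
    have := grad_sqdist xbar z => /rowP/(_ i); rewrite !mxE => <-.
    by apply/derivableP/diff_derivable/differentiable_sqdist.
  have ? := is_derive_penalty (delta_mx 0 i)
    (fun j => dg j z) (fun j => dh j z).
  have -> : 'D_(delta_mx 0 i) P z = 'D_(delta_mx 0 i) phi z
      + (z 0 i - xbar 0 i)
      + nu * (\sum_j 2 * h j z * 'D_(delta_mx 0 i) (h j) z +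
              \sum_j 2 * Num.max (g j z) 0 * 'D_(delta_mx 0 i) (g j) z).
    apply: derive_val; apply: is_derive_eq.
    by rewrite /GRing.scale/=; field.
  rewrite mulrDr !mulr_sumr => eq0.
  rewrite (_ : _ + _ = - (z 0 i - xbar 0 i)) ?normrN ?(lt_trans (zr i))//.
  under eq_bigr do rewrite mxE -mulrA.
  under [X in _ + (_ + X)]eq_bigr do rewrite mxE -mulrA.
  by move: eq0; lra.
Unshelve. all: by end_near. Qed.

(** * Sufficient decrease of the reweighted step *)

(** A concave function lies below its tangent. With a = b e^y the claim reduces
    to e^{py} <= p e^y + 1 - p, that is 1 <= p e^{(1-p)y} + (1-p) e^{-py}, and
    the linear terms of the two tangent bounds of exp at 0 cancel. *)
Lemma powR_tangent (R : realType) (p a b : R) :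
  0 < p <= 1 -> 0 < a -> 0 < b ->
  a `^ p <= b `^ p + p * b `^ (p - 1) * (a - b).
Proof.
move=> /andP[p0 p1] a0 b0; set y := ln a - ln b.
have ay : a = b * expR y by rewrite expRB !lnK// mulrC divfK ?gt_eqF.
have apE : a `^ p = b `^ p * expR (p * y).
  by rewrite /powR !gt_eqF// -expRD mulrBr subrKC.
have bpE : b `^ p = b * b `^ (p - 1) by rewrite mulr_powRB1 ?ltW.
suff : expR (p * y) <= 1 + p * (expR y - 1).
  move=> h; have /ler_wpM2l/(_ _ _ h) := powR_ge0 b p.
  by rewrite apE bpE {1}ay; lra.
have h1 := expR_ge1Dx ((1 - p) * y); have h2 := expR_ge1Dx (- (p * y)).
have e1 : expR y = expR (p * y) * expR ((1 - p) * y).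
  by rewrite -expRD; congr expR; ring.
have e2 : 1 = expR (p * y) * expR (- (p * y)) by rewrite -expRD subrr expR0.
suff : expR (p * y) * 1 <= expR (p * y) *
    (p * expR ((1 - p) * y) + (1 - p) * expR (- (p * y))).
  by rewrite e1; have /= := congr1 (fun t => (1 - p) * t) e2; lra.
by rewrite ler_wpM2l ?expR_ge0//; nra.
Qed.

Definition weighted_l1 (R : realType) (n : nat) (lambda : R) (w : 'I_n -> R)
    (u : 'rV[R]_n) : R :=
  lambda * \sum_(i < n) w i * `|u 0 i|.

Lemma weighted_l1_convex (R : realType) (n : nat) (lambda : R) (w : 'I_n -> R)
    (v u : 'rV[R]_n) (t : R) :
  0 <= lambda -> (forall i, 0 <= w i) -> 0 <= t <= 1 ->
  weighted_l1 lambda w (v + t *: (u - v)) <=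
    weighted_l1 lambda w v
    + t * (weighted_l1 lambda w u - weighted_l1 lambda w v).
Proof.
move=> l0 w0 /andP[t0 t1]; rewrite /weighted_l1 -mulrBr mulrCA.
rewrite -mulrDr ler_wpM2l//.
rewrite -sumrB mulr_sumr -big_split/= ler_sum// => i _.
rewrite !mxE -mulrBr mulrCA.
rewrite -mulrDr ler_wpM2l//.
rewrite (_ : v 0 i + _ = (1 - t) * v 0 i + t * u 0 i); last by ring.
apply: (le_trans (ler_normD _ _)).
rewrite !normrM (ger0_norm t0) ger0_norm; lra.
Qed.

(** The weights are the slopes of t `^ p at |x_i| + eps_i, so the decrease of
    the weighted l1 term controls that of the smoothed power term; lowering
    eps to eps' only helps. Each of the two strong convexity estimates
    contributes M/2 to the constant, and the upper bound on f takes L/2 away. *)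
Lemma reweighted_step_decrease (R : realType) (n : nat) (p lambda L M : R)
    (A : set 'rV[R]_n) (f q : 'rV[R]_n -> R) (x y eps eps' : 'rV[R]_n) :
  0 < p <= 1 -> 0 <= lambda ->
  (forall u, differentiable f u) -> lipschitz_gradient L f ->
  convex_set A -> differentiable q x -> strongly_convex M q ->
  grad q x = grad f x -> A x ->
  (forall i, 0 < eps' 0 i) -> (forall i, eps' 0 i <= eps 0 i) ->
  is_argmin A (reweighted_model p lambda q x eps) y ->
  smoothed_objective p lambda f y eps' + (M - L / 2) * enorm (y - x) ^+ 2 <=
    smoothed_objective p lambda f x eps.
Proof.
move=> p01 l0 df fL Aconv dq sq gq Ax eps'0 eps'eps ymin.
have /andP[p0 p1] := p01.
have eps0 i : 0 < eps 0 i := lt_le_trans (eps'0 i) (eps'eps i).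
pose w := weight p x eps; pose psi := weighted_l1 lambda w.
have w0 i : 0 <= w i by rewrite mulr_ge0 ?powR_ge0 ?ltW.
have growth : q y + psi y + M / 2 * enorm (x - y) ^+ 2 <= q x + psi x.
  apply: (strong_argmin_growth Aconv sq _ ymin Ax) => u v t t01.
  exact: weighted_l1_convex.
have enormC : enorm (x - y) = enorm (y - x).
  by rewrite /enorm; congr Num.sqrt; apply: eq_bigr => i _;
    rewrite !mxE -sqrrN opprB.
rewrite enormC in growth.
have := strongly_convex_gradient y sq dq; rewrite gq => lower.
have upper := descent_lemma x y df fL.
have maj : \sum_(i < n) (`|y 0 i| + eps' 0 i) `^ p <=
    \sum_(i < n) (`|x 0 i| + eps 0 i) `^ p
    + (\sum_(i < n) w i * `|y 0 i| - \sum_(i < n) w i * `|x 0 i|).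
  rewrite -sumrB -big_split/= ler_sum// => i _.
  have := @powR_tangent _ p (`|y 0 i| + eps 0 i) (`|x 0 i| + eps 0 i) p01.
  rewrite !ltr_wpDl//= => /(_ isT isT) tangent.
  rewrite (@le_trans _ _ ((`|y 0 i| + eps 0 i) `^ p))//.
    by rewrite ge0_ler_powR ?nnegrE ?(ltW p0) ?addr_ge0 ?(ltW (eps'0 i))
      ?(ltW (eps0 i))// lerD2l.
  by rewrite (le_trans tangent)// /w /weight; lra.
have := ler_wpM2l l0 maj.
by rewrite /smoothed_objective /psi /weighted_l1 in growth *; lra.
Qed.

Lemma coord_le_mx_norm (R : realType) (n : nat) (u : 'rV[R]_n) (i : 'I_n) :
  `|u 0 i| <= `|u|.
Proof.
rewrite {2}/Num.norm/= mx_normrE.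
exact: (le_bigmax _ (fun ij : 'I_1 * 'I_n => `|u ij.1 ij.2|) (0, i)).
Qed.

(** The level set lies in a compact box, where f is bounded below; outside the
    level set the objective exceeds c. *)
Lemma objective_lower_bound (R : realType) (n : nat) (p lambda c : R)
    (f : 'rV[R]_n -> R) :
  0 <= lambda -> continuous f ->
  bounded_set [set u | objective p lambda f u <= c] ->
  exists m, forall u, m <= objective p lambda f u.
Proof.
move=> l0 cf [B [_ HB]].
have cB := @compact_box R n 0 (Num.max (B + 1) 0).
have [|m _ mmin] := EVT_min_rV _ cB (continuous_subspaceT cf).
  by exists 0 => i /=; rewrite subrr normr0 le_max lexx orbT.
exists (Num.min (f m) c) => u.
have [uc|uc] := leP (objective p lambda f u) c; last first.
  by rewrite ge_min (ltW uc) orbT.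
rewrite ge_min (@le_trans _ _ (f u))//.
  apply: mmin; rewrite inE => i /=; rewrite mxE subr0.
  by rewrite (le_trans (coord_le_mx_norm _ _))// le_max (HB (B + 1)) ?ltrDl.
by rewrite lerDl mulr_ge0// sumr_ge0// => i _; rewrite powR_ge0.
Qed.

(** * Convergence of the iterates along a subsequence *)

(** The bound makes the index map tend to infinity, so that limits of the whole
    sequence pass to the subsequence; being strict, it leaves out the index 0,
    that of a possibly infeasible starting point. *)
Lemma cluster_subsequence (R : realType) (n : nat) (x : nat -> 'rV[R]_n)
    (xbar : 'rV[R]_n) :
  cluster (x @ \oo) xbar ->
  exists kappa : nat -> nat,
    (forall j, (j < kappa j)%N) /\ (x \o kappa) @ \oo --> xbar.
Proof.
move=> clx.
have pick j : exists k, (j < k)%N /\ ball xbar j.+1%:R^-1 (x k).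
  have Aj : (x @ \oo) (x @` [set k | (j < k)%N]).
    by exists j.+1 => // k jk; exists k.
  have Bj : nbhs xbar (ball xbar j.+1%:R^-1).
    by apply: nbhsx_ballx; rewrite invr_gt0 ltr0n.
  have [_ [[k jk <-] xk]] := clx _ _ Aj Bj.
  by exists k.
have [kappa kappaP] := choice pick.
exists kappa; split=> [j|]; first by case: (kappaP j).
apply/cvg_ballP => e e0; near=> j.
apply: (@le_ball _ _ _ j.+1%:R^-1); last by case: (kappaP j).
apply/ltW; near: j; exact: near_infty_natSinv_lt (PosNum e0).
Unshelve. all: by end_near. Qed.

Lemma vanishing_of_sufficient_decrease (R : realType) (c m : R)
    (S d : nat -> R) :
  0 < c -> (forall k, 0 <= d k) -> (forall k, m <= S k) ->
  (forall k, S k.+1 + c * d k ^+ 2 <= S k) ->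
  d @ \oo --> (0 : R).
Proof.
move=> c0 d0 Sm Sd.
have Scv : cvgn S.
  apply: nonincreasing_is_cvgn; last by exists m => _ [k _ <-].
  apply/nonincreasing_seqP => k.
  by have := Sd k; have := sqr_ge0 (d k); nra.
have diff0 : (fun k => S k - S k.+1) @ \oo --> (0 : R).
  rewrite -(subrr (limn S)); apply: cvgB => //.
  by rewrite cvg_shiftS.
apply/cvgrPdist_lt => e e0.
have ce0 : 0 < c * e ^+ 2 by rewrite mulr_gt0// exprn_gt0.
near=> k.
rewrite sub0r normrN ger0_norm// -(@ltr_pXn2r _ 2)// ?nnegrE ?(ltW e0)//.
have : S k - S k.+1 < c * e ^+ 2.
  near: k; exact: (cvgr_lt 0 diff0 _ ce0).
by rewrite -(ltr_pM2l c0); have := Sd k; lra.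
Unshelve. all: by end_near. Qed.

Lemma smoothing_vanishes (R : realType) (n : nat) (alpha : R)
    (eps : nat -> 'rV[R]_n) (i : 'I_n) :
  0 < alpha < 1 -> (forall k, 0 < eps k.+1 0 i < alpha * eps k 0 i) ->
  (fun k => eps k 0 i) @ \oo --> (0 : R).
Proof.
move=> /andP[a0 a1] epsP.
have bound k : eps k 0 i <= eps 0%N 0 i * alpha ^+ k.
  elim: k => [|k ih]; first by rewrite expr0 mulr1.
  have /andP[_ /ltW h] := epsP k; apply: (le_trans h).
  by rewrite exprSr mulrA mulrC ler_wpM2r// ltW.
apply: (@squeeze_cvgr _ _ _ _ (fun=> 0) (geometric (eps 0%N 0 i) alpha)).
- near=> k; rewrite bound andbT -(@prednK k); last by near: k; exists 1%N.
  by have /andP[/ltW] := epsP k.-1.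
- exact: cvg_cst.
- by apply: cvg_geometric; rewrite ger0_norm ?ltW.
Unshelve. all: by end_near. Qed.

Lemma cvg_enorm_sub0 (R : realType) (n : nat) (u v : nat -> 'rV[R]_n)
    (l : 'rV[R]_n) :
  u @ \oo --> l -> (fun k => enorm (v k - u k)) @ \oo --> (0 : R) ->
  v @ \oo --> l.
Proof.
move=> ul vu; apply/cvg_ballP => e e0.
have e20 : 0 < e / 2 by rewrite divr_gt0.
near=> k.
split=> // i j; rewrite ord1 /ball/=.
have uk : ball l (e / 2) (u k).
  by near: k; exact: (cvg_ball ul e20).
have vk : enorm (v k - u k) < e / 2.
  by near: k; exact: (cvgr_lt 0 vu _ e20).
have [_ /(_ 0 j)] := uk; rewrite /ball/=.
have := coord_le_enorm (v k - u k) j; rewrite !mxE distrC.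
have := ler_distD (u k 0 j) (l 0 j) (v k 0 j); lra.
Unshelve. all: by end_near. Qed.

Lemma cvg_coord (R : realType) (n : nat) (u : nat -> 'rV[R]_n)
    (l : 'rV[R]_n) (i : 'I_n) :
  u @ \oo --> l -> (fun k => u k 0 i) @ \oo --> l 0 i.
Proof.
move=> ul.
apply: (@continuous_cvg _ _ _ _ _ u (fun v : 'rV[R]_n => v 0 i)) ul.
exact: coord_continuous.
Qed.

Lemma sg_powR_continuous (R : realType) (a t : R) :
  t != 0 -> {for t, continuous (fun s : R => Num.sg s * `|s| `^ a)}.
Proof.
move=> t0; apply: cvgM.
  apply: cvg_near_cst; have [tneg|tge0] := ltP t 0.
    by near=> s; rewrite !ltr0_sg//; near: s; exact: lt_nbhsl.
  have tpos : 0 < t by rewrite lt_neqAle eq_sym t0.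
  by near=> s; rewrite !gtr0_sg//; near: s; exact: lt_nbhsr.
have cnorm : {for t, continuous (fun s : R => `|s|)} by exact: norm_continuous.
suff cpow : {for `|t|, continuous (@powR R ^~ a)}.
  by exact: (continuous_cvg _ cpow cnorm).
have nt : 0 < `|t| by rewrite normr_gt0.
have [dp _] := is_derive1_powR a nt.
exact/differentiable_continuous/derivable1_diffP.
Unshelve. all: by end_near. Qed.

(** * Passage to the limit in the subproblems *)

(** The detour F xbar, F (x j) = G (x j), G xbar, G (y j) uses equicontinuity
    at the fixed point xbar for the two last steps, uniformly in the index. *)
Lemma equicontinuous_cvg (R : realType) (n : nat)
    (G : nat -> 'rV[R]_n -> 'rV[R]_n)
    (F : 'rV[R]_n -> 'rV[R]_n) (kappa : nat -> nat) (x y : nat -> 'rV[R]_n)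
    (xbar : 'rV[R]_n) :
  equicontinuous [set: nat] G -> {for xbar, continuous F} ->
  (forall j, G (kappa j) (x j) = F (x j)) ->
  x @ \oo --> xbar -> y @ \oo --> xbar ->
  (fun j => G (kappa j) (y j)) @ \oo --> F xbar.
Proof.
move=> Gequi cF GF xx yx; apply/cvg_ballP => e e0.
have e30 : 0 < e / 3 by rewrite divr_gt0.
have Gnear := Gequi xbar _ (entourage_ball _ (PosNum e30)).
have Fx : (fun j => F (x j)) @ \oo --> F xbar.
  by exact: (continuous_cvg _ cF xx).
near=> j.
have b1 : ball (F xbar) (e / 3) (F (x j)) by near: j; exact: (cvg_ball Fx e30).
have b2 : ball (G (kappa j) xbar) (e / 3) (G (kappa j) (x j)).
  move: (kappa j) (I : [set: nat] (kappa j)); near: j; exact: (xx _ Gnear).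
have b3 : ball (G (kappa j) xbar) (e / 3) (G (kappa j) (y j)).
  move: (kappa j) (I : [set: nat] (kappa j)); near: j; exact: (yx _ Gnear).
have -> : e = e / 3 + e / 3 + e / 3 by field.
apply: ball_triangle b3; apply: ball_triangle b1 _.
by rewrite -GF; exact: ball_sym.
Unshelve. all: by end_near. Qed.

(** At the coordinates where xbar vanishes the weights may tend to infinity.
    There u vanishes too, and the corresponding term - w_i |y_i| is
    nonpositive, so it is bounded by 0 before the limit is taken. At the other
    coordinates the weights converge, by continuity of the power function away
    from 0. *)
Lemma limit_variational (R : realType) (n : nat) (p lambda : R)
    (A : set 'rV[R]_n) (q : nat -> 'rV[R]_n -> R) (x y eps : nat -> 'rV[R]_n)
    (d xbar u : 'rV[R]_n) :
  0 <= p -> 0 <= lambda -> convex_set A ->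
  (forall j v, differentiable (q j) v) ->
  (forall j,
     is_argmin A (reweighted_model p lambda (q j) (x j) (eps j)) (y j)) ->
  x @ \oo --> xbar -> y @ \oo --> xbar ->
  (forall i, (fun j => eps j 0 i) @ \oo --> (0 : R)) ->
  (fun j => grad (q j) (y j)) @ \oo --> d ->
  A u -> (forall i, xbar 0 i = 0 -> u 0 i = 0) ->
  0 <= dot d (u - xbar)
       + lambda * \sum_(i < n) p * `|xbar 0 i| `^ (p - 1)
                    * (`|u 0 i| - `|xbar 0 i|).
Proof.
move=> p0 l0 Aconv dq ymin xx yx eps0 gq Au u0.
pose w j := weight p (x j) (eps j).
have w_ge0 j i : 0 <= w j i by rewrite mulr_ge0// powR_ge0.
(* T bounds the difference of the weighted l1 terms at u and at y j *)
pose T j i := if xbar 0 i == 0 then 0 else w j i * (`|u 0 i| - `|y j 0 i|).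
pose V j : R := dot (grad (q j) (y j)) (u - y j) + lambda * \sum_(i < n) T j i.
have V_ge0 j : 0 <= V j.
  have wconv v v' t : 0 <= t <= 1 ->
     weighted_l1 lambda (w j) (v + t *: (v' - v)) <=
     weighted_l1 lambda (w j) v
     + t * (weighted_l1 lambda (w j) v' - weighted_l1 lambda (w j) v).
    exact: weighted_l1_convex.
  have := argmin_variational Aconv (dq j (y j)) wconv (ymin j) Au.
  suff : weighted_l1 lambda (w j) u - weighted_l1 lambda (w j) (y j) <=
      lambda * \sum_(i < n) T j i by rewrite /V; lra.
  rewrite /weighted_l1 -mulrBr ler_wpM2l// -sumrB ler_sum// => i _.
  rewrite /T; case: eqP => [/u0 ->|_]; last by rewrite mulrBr.
  by rewrite normr0 mulr0 sub0r oppr_le0 mulr_ge0.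
have wcvg i : xbar 0 i != 0 ->
    (fun j => w j i) @ \oo --> p * `|xbar 0 i| `^ (p - 1).
  move=> xi0; apply: cvgMr.
  have ni : 0 < `|xbar 0 i| by rewrite normr_gt0.
  have [dp _] := is_derive1_powR (p - 1) ni.
  have cp : {for `|xbar 0 i|, continuous (@powR R ^~ (p - 1))}.
    exact/differentiable_continuous/derivable1_diffP.
  have base : (fun j => `|x j 0 i| + eps j 0 i) @ \oo --> `|xbar 0 i|.
    rewrite -[X in _ --> X]addr0; apply: cvgD; last exact: eps0.
    by apply: cvg_norm; exact: cvg_coord.
  exact: (continuous_cvg _ cp base).
have Vcvg : V @ \oo --> dot d (u - xbar)
    + lambda * \sum_(i < n) p * `|xbar 0 i| `^ (p - 1)
                  * (`|u 0 i| - `|xbar 0 i|).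
  apply: cvgD.
    apply: (cvg_big (op := +%R)) => [|i _]; first exact: add_continuous.
    apply: cvgM; first exact: cvg_coord.
    by apply: (@cvg_coord _ _ (fun j => u - y j)); apply: cvgB => //;
      exact: cvg_cst.
  apply: cvgMr.
  apply: (cvg_big (op := +%R)) => [|i _]; first exact: add_continuous.
  rewrite /T; case: (eqVneq (xbar 0 i) 0) => [xi0|xi0].
    by rewrite xi0 (u0 _ xi0) subrr mulr0; exact: cvg_cst.
  apply: cvgM; first exact: wcvg.
  apply: cvgB; first exact: cvg_cst.
  by apply: cvg_norm; exact: cvg_coord.
rewrite -(cvg_lim (@Rhausdorff R) Vcvg); apply: limr_ge.
  by apply/cvg_ex; eexists; exact: Vcvg.
by near=> j.
Unshelve. all: by end_near. Qed.

(** * From stationarity to AKKT *)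

Lemma cvg_infty_of_ge (kappa : nat -> nat) :
  (forall j, (j <= kappa j)%N) -> kappa @ \oo --> \oo.
Proof.
move=> kappa_ge A [N _ NA]; exists N => // j /= Nj; apply: NA => /=.
exact: leq_trans Nj (kappa_ge j).
Qed.

Lemma pinned_dot (R : realType) (n : nat) (b : bool) (k : 'I_n) (u : 'rV[R]_n) :
  dot (b%:R *: delta_mx 0 k) u = b%:R * u 0 k.
Proof.
rewrite -(dot_delta u k) /dot mulr_sumr; apply: eq_bigr => i _.
by rewrite mxE -mulrA [delta_mx _ _ _ _ * _]mulrC.
Qed.

(** Near xbar the absolute value of a nonzero coordinate is linear, so the
    hypothesis says that xbar is a local minimizer of the linear function
    [dot c] subject to the given constraints and to u_i = 0 wherever xbar_i = 0. The latter are
    added to the equality constraints; their gradients are multiples of basis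
    vectors that do not touch the rows in AKKT. *)
Lemma stationary_AKKT (R : realType) (n : nat) (I E : finType)
    (p lambda : R) (f : 'rV[R]_n -> R) (g : I -> 'rV[R]_n -> R)
    (h : E -> 'rV[R]_n -> R) (xbar : 'rV[R]_n) :
  continuous (grad f) ->
  (forall j u, differentiable (g j) u) ->
  (forall j u, differentiable (h j) u) ->
  feasible_set g h xbar ->
  (forall u, feasible_set g h u -> (forall i, xbar 0 i = 0 -> u 0 i = 0) ->
     0 <= dot (grad f xbar) (u - xbar)
          + lambda * \sum_(i < n) p * `|xbar 0 i| `^ (p - 1)
                       * (`|u 0 i| - `|xbar 0 i|)) ->
  AKKT p lambda f g h xbar.
Proof.
move=> cf dg dh fxbar stat; split=> //.
pose reg (v : 'rV[R]_n) i := lambda * p * Num.sg (v 0 i) * `|v 0 i| `^ (p - 1).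
(* Since Num.sg 0 = 0, reg xbar i is 0 at the zero coordinates. *)
pose c : 'rV[R]_n := \row_i (grad f xbar 0 i + reg xbar i).
pose pin (k : 'I_n) : 'rV[R]_n -> R := dot ((xbar 0 k == 0)%:R *: delta_mx 0 k).
pose h' (e : E + 'I_n) := match e with inl j => h j | inr k => pin k end.
have dh' e u : differentiable (h' e) u.
  by case: e => [j|k] /=; [exact: dh|exact: differentiable_dot].
have fxbar' : feasible_set g h' xbar.
  case: fxbar => gx hx; split=> // -[j|k] /=; first exact: hx.
  by rewrite /pin pinned_dot; case: eqP => [->|]; rewrite ?mulr0 ?mul0r.
have same_sign : \forall u \near xbar, forall i : 'I_n, xbar 0 i != 0 ->
    `|(u : 'rV[R]_n) 0 i| = Num.sg (xbar 0 i) * u 0 i.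
  suff near_i (i : 'I_n) : \forall u \near xbar, xbar 0 i != 0 ->
      `|(u : 'rV[R]_n) 0 i| = Num.sg (xbar 0 i) * u 0 i.
    by exact: filter_forall near_i.
  have ci : {for xbar, continuous (fun u : 'rV[R]_n => u 0 i)}.
    exact: coord_continuous.
  have [xneg|xge0] := ltP (xbar 0 i) 0.
    have near_neg : \forall u \near xbar, (u : 'rV[R]_n) 0 i < 0.
      by exact: (cvgr_lt _ ci _ xneg).
    near=> u => _; have u0 : u 0 i < 0 by near: u.
    by rewrite ltr0_norm// ltr0_sg// mulN1r.
  have [->|xi0] := eqVneq (xbar 0 i) 0; first by near=> u.
  have xpos : 0 < xbar 0 i by rewrite lt_neqAle eq_sym xi0.
  have near_pos : \forall u \near xbar, 0 < (u : 'rV[R]_n) 0 i.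
    by exact: (cvgr_gt _ ci _ xpos).
  near=> u => _; have u0 : 0 < u 0 i by near: u.
  by rewrite gtr0_norm// gtr0_sg// mul1r.
have min_c : \forall u \near xbar,
    feasible_set g h' u -> dot c xbar <= dot c u.
  near=> u; move=> [gu hu].
  have u_sign : forall i : 'I_n, xbar 0 i != 0 ->
      `|u 0 i| = Num.sg (xbar 0 i) * u 0 i.
    by near: u.
  have u0 i : xbar 0 i = 0 -> u 0 i = 0.
    by move=> xi; have := hu (inr i); rewrite /= /pin pinned_dot xi eqxx mul1r.
  have := stat u (conj gu (fun j => hu (inl j))) u0.
  rewrite -[dot c xbar <= _]subr_ge0; set lin := (X in 0 <= X -> _).
  suff -> : dot c u - dot c xbar = lin by []; rewrite /lin.
  rewrite /dot mulr_sumr -big_split -sumrB; apply: eq_bigr => i _ /=.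
  rewrite !mxE /reg; have [xi|xi] := eqVneq (xbar 0 i) 0.
    by rewrite xi u0// normr0; ring.
  by rewrite u_sign// [`|xbar 0 i|]normrEsg; ring.
have approx (nu : nat) : exists t : 'rV[R]_n * (I -> R) * (E + 'I_n -> R),
    [/\ forall i, `|t.1.1 0 i - xbar 0 i| < nu.+1%:R^-1,
        forall j, 0 <= t.1.2 j,
        forall j, g j xbar < 0 -> t.1.2 j = 0 &
        forall i, `|c 0 i + (\sum_e t.2 e * grad (h' e) t.1.1 0 i
                    + \sum_j t.1.2 j * grad (g j) t.1.1 0 i)| < nu.+1%:R^-1].
  have nu0 : 0 < nu.+1%:R^-1 :> R by rewrite invr_gt0 ltr0n.
  have [z [yI [yE [zx yI0 yIin res]]]] :=
    sequential_optimality (differentiable_dot c) dg dh' fxbar' min_c nu0.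
  by exists (z, yI, yE); split=> // i; have := res i; rewrite grad_dot.
have [t tP] := choice approx.
pose z nu := (t nu).1.1.
have zx : z @ \oo --> xbar.
  apply/cvg_ballP => e e0; near=> nu; split=> // k i.
  rewrite ord1 /ball/= distrC.
  have [/(_ i) zi _ _ _] := tP nu; apply: (lt_trans zi).
  by near: nu; exact: near_infty_natSinv_lt (PosNum e0).
exists z, (fun nu => (t nu).1.2), (fun nu j => (t nu).2 (inl j)); split=> //.
  by move=> nu j _; have [_ ] := tP nu.
move=> i xi.
pose res nu := c 0 i + (\sum_e (t nu).2 e * grad (h' e) (z nu) 0 i
                    + \sum_j (t nu).1.2 j * grad (g j) (z nu) 0 i).
have res0 : res @ \oo --> (0 : R).
  apply/cvgrPdist_lt => e e0; near=> nu; rewrite sub0r normrN.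
  have [_ _ _ /(_ i) ri] := tP nu; apply: (lt_trans ri).
  by near: nu; exact: near_infty_natSinv_lt (PosNum e0).
have grad0 : (fun nu => grad f (z nu) 0 i - grad f xbar 0 i) @ \oo --> (0 : R).
  rewrite -(subrr (grad f xbar 0 i)); apply: cvgB; last exact: cvg_cst.
  apply: (@cvg_coord _ _ (fun nu => grad f (z nu))).
  exact: (continuous_cvg _ (cf xbar) zx).
have reg0 : (fun nu => reg (z nu) i - reg xbar i) @ \oo --> (0 : R).
  rewrite -(subrr (reg xbar i)); apply: cvgB; last exact: cvg_cst.
  have zi := cvg_coord (i := i) zx.
  have sgc := sg_powR_continuous (a := p - 1) xi.
  have : (fun nu => lambda * p * (Num.sg (z nu 0 i) * `|z nu 0 i| `^ (p - 1)))
      @ \oo --> lambda * p * (Num.sg (xbar 0 i) * `|xbar 0 i| `^ (p - 1)).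
    by apply: cvgMr; exact: (continuous_cvg _ sgc zi).
  by under eq_fun do rewrite mulrA; rewrite mulrA.
rewrite [X in X @ _ --> _](_ : _ = fun nu =>
    grad f (z nu) 0 i - grad f xbar 0 i + (reg (z nu) i - reg xbar i) + res nu).
  rewrite -[X in _ --> X]addr0 -[X in _ --> X + _]addr0.
  by apply: cvgD => //; exact: cvgD.
apply/funext => nu.
have pins0 : \sum_k (t nu).2 (inr k) * grad (pin k) (z nu) 0 i = 0.
  rewrite big1// => k _; rewrite grad_dot !mxE eqxx/=.
  have [<-|_] := eqVneq i k; first by rewrite (negPf xi) mul0r mulr0.
  by rewrite !mulr0.
have inactive : \sum_j (t nu).1.2 j * grad (g j) (z nu) 0 i =
    \sum_(j | g j xbar == 0) (t nu).1.2 j * grad (g j) (z nu) 0 i.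
  rewrite [RHS]big_mkcond; apply: eq_bigr => j _; case: eqP => // gj.
  have gj0 : g j xbar < 0.
    by rewrite lt_neqAle; case: fxbar => -> _; rewrite andbT; apply/eqP.
  by have [_ _ /(_ j gj0) -> _] := tP nu; rewrite mul0r.
have cE : c 0 i = grad f xbar 0 i + reg xbar i by rewrite mxE.
by rewrite /res big_sumType /= pins0 addr0 inactive cE /reg; ring.
Unshelve. all: by end_near. Qed.

(** * Cluster points of the algorithm *)

Theorem theorem4p3 (R : realType) (n : nat) (I E : finType)
    (p lambda Lf M alpha : R)
    (f0 : 'rV[R]_n -> R) (g : I -> 'rV[R]_n -> R) (h : E -> 'rV[R]_n -> R)
    (Q : nat -> 'rV[R]_n -> R) (x eps : nat -> 'rV[R]_n)
    (hp : 0 < p <= 1) (hlambda : 0 < lambda) (hLf : 0 <= Lf)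
    (hf0 : continuously_differentiable f0)
    (hf0_lip : lipschitz_gradient Lf f0)
    (hg : forall j, continuously_differentiable (g j))
    (hh : forall j, continuously_differentiable (h j))
    (hclosed : closed (feasible_set g h))
    (hconvex : convex_set (feasible_set g h))
    (hQ_smooth : forall k, continuously_differentiable (Q k))
    (hQ_equi : equicontinuous [set: nat] (fun k => grad (Q k)))
    (hQ_convex : forall k, convex_function [set: 'rV[R]_n] (Q k))
    (hrun : irl1_run p lambda (feasible_set g h) Q alpha x eps)
    (hlevel : bounded_set
       [set u | objective p lambda f0 u
                <= smoothed_objective p lambda f0 (x 0%N) (eps 0%N)])
    (hQ_grad : forall k, grad (Q k) (x k) = grad f0 (x k))
    (hLf_gt0 : 0 < Lf / 2) (hM : Lf / 2 < M)
    (hQ_strong : forall k, strongly_convex M (Q k)) :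
  forall xbar, cluster (x @ \oo) xbar -> AKKT p lambda f0 g h xbar.
Proof.
move=> xbar clx.
have [alpha01 eps0_gt0 xmin epsP] := hrun.
have /andP[p0 p1] := hp.
have [df cgf] := hf0.
have dg j u : differentiable (g j) u by have [] := hg j.
have dh j u : differentiable (h j) u by have [] := hh j.
have dQ k u : differentiable (Q k) u by have [] := hQ_smooth k.
have Gx k : feasible_set g h (x k.+1) by case: (xmin k).
have eps_gt0 k i : 0 < eps k 0 i.
  by case: k => [//|k]; have /andP[] := epsP k i.
have eps_decr k i : eps k.+1 0 i <= eps k 0 i.
  have /andP[_ /ltW lt_alpha] := epsP k i; apply: (le_trans lt_alpha).
  by rewrite ler_piMl ?(ltW (eps_gt0 _ _))//; case/andP: alpha01 => _ /ltW.
have [m Fm] := objective_lower_bound (ltW hlambda)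
  (fun u => differentiable_continuous (df u)) hlevel.
(* x 0 may be infeasible, so the decrease is used from x 1 on. *)
have steps0 : (fun k => enorm (x k.+2 - x k.+1)) @ \oo --> (0 : R).
  apply: (@vanishing_of_sufficient_decrease _ (M - Lf / 2) m
    (fun k => smoothed_objective p lambda f0 (x k.+1) (eps k.+1))).
  - by rewrite subr_gt0.
  - by move=> k; exact: enorm_ge0.
  - move=> k; apply: (le_trans (Fm (x k.+1))).
    rewrite lerD2l ler_wpM2l ?(ltW hlambda)//.
    rewrite ler_sum// => i _; have e0 := ltW (eps_gt0 k.+1 i).
    by rewrite ge0_ler_powR ?nnegrE ?addr_ge0 ?(ltW p0)// lerDl.
  - move=> k; exact: (reweighted_step_decrease hp (ltW hlambda) df hf0_lip
      hconvex (dQ _ _) (hQ_strong _) (hQ_grad _) (Gx k) (eps_gt0 _)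
      (eps_decr _) (xmin _)).
have [kappa [kappa_gt xk]] := cluster_subsequence clx.
have kappa_prec j : kappa j = (kappa j).-1.+1.
  by rewrite prednK// (leq_trans _ (kappa_gt j)).
have yk : (fun j => x (kappa j).+1) @ \oo --> xbar.
  apply: (cvg_enorm_sub0 xk).
  have kp : (fun j => (kappa j).-1) @ \oo --> \oo.
    by apply: cvg_infty_of_ge => j; have := kappa_gt j; rewrite kappa_prec.
  rewrite (_ : (fun _ => _) =
    (fun k => enorm (x k.+2 - x k.+1)) \o (fun j => (kappa j).-1)).
    exact: (cvg_comp _ _ kp steps0).
  by apply/funext => j /=; rewrite -kappa_prec.
have fxbar : feasible_set g h xbar.
  apply: (@closed_cvg _ _ \oo _ (fun j => x (kappa j).+1) _ hclosed) yk.
  by near=> j.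
apply: stationary_AKKT => // u Gu u0.
apply: (@limit_variational _ _ p lambda (feasible_set g h) (Q \o kappa)
   (x \o kappa) (fun j => x (kappa j).+1) (eps \o kappa)) => //.
- exact: ltW.
- exact: ltW.
- by move=> j v; exact: dQ.
- by move=> j; exact: xmin.
- move=> i; have kc : kappa @ \oo --> \oo.
    by apply: cvg_infty_of_ge => j; exact: ltnW.
  exact: (cvg_comp _ _ kc (smoothing_vanishes alpha01 (epsP ^~ i))).
- apply: (equicontinuous_cvg hQ_equi (cgf xbar) _ xk yk) => j.
  exact: hQ_grad.
Unshelve. all: by end_near. Qed.
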